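(* Let $D(k)\equiv0$ and let $d\ge1$ be a fixed delay. Suppose the adaptive controller $$u(k)=\frac{1}{\hat\theta_{d,\nu}(k)}\left(y_{\mathrm{ref}}(k+d)-\hat\vartheta_d(k)^T\phi_d(k)\right),$$ $$\hat\theta_d(k)=\hat\theta_d(k-1)+\frac{a(k)\Phi_d(k-d)\varepsilon_d(k)}{1+\Phi_d(k-d)^T\Phi_d(k-d)},\qquad \varepsilon_d(k)=y(k)-\hat\theta_d(k-1)^T\Phi_d(k-d),$$ with $a(k)$ as defined in the context, is used to control the plant $y(k+d)=\vartheta_d^{*T}\phi_d(k)+\beta_0^du(k)$. Assume that an upper bound for the orders of the polynomials $A,B$ is known, that all zeros of $B(q^{-1})$ lie strictly inside the closed unit disk, and that the bounded reference $y_{\mathrm{ref}}(k)$ is sufficiently rich of constant order $p$ for all $k$, where $1\le p\le M$. Then: (i) $\lim_{k\to\infty}e(k)=\lim_{k\to\infty}\left(y(k)-y_{\mathrm{ref}}(k)\right)=0$; (ii) $\Phi_d(k)\in\Omega_p\subset\mathbb{R}^M$ as $k\to\infty$, that is, there is a subspace $\Omega_p\subset\mathbb{R}^M$ with $\dim\Omega_p=p$ such that the distance from $\Phi_d(k)$ to $\Omega_p$ tends to $0$ as $k\to\infty$; (iii) $\tilde\theta_d(k)=\hat\theta_d(k)-\theta_d^*$ converges to $\bar\Omega_{M-p}$ (the distance from $\tilde\theta_d(k)$ to $\bar\Omega_{M-p}$ tends to $0$), where $$\bar\Omega_{M-p}:=\left\{x\;\middle|\;\Phi_d(k)^Tx=0\text{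 for }k\to\infty\right\}=\left\{x\in\mathbb{R}^M\;\middle|\;\lim_{k\to\infty}\Phi_d(k)^Tx=0\right\}.$$
   Context: $u(k),y(k)\in\mathbb{R}$ are the plant input and output, $q^{-1}$ is the backward shift, $A(q^{-1})=1+\sum_{l=1}^{m_1}a_lq^{-l}$, $B(q^{-1})=b_0+\sum_{l=1}^{m_2}b_lq^{-l}$ with $b_0\ne 0$; the coefficients are unknown. The plant with disturbance $D$ is $A(q^{-1})y(k)=q^{-d}(B(q^{-1})u(k)+D(k))$. $F$ (degree $\le d-1$ in $q^{-1}$) and $\alpha$ (degree $\le m_1-1$) are the unique polynomials with $1=F(q^{-1})A(q^{-1})+q^{-d}\alpha(q^{-1})$, and $\beta=FB$; write $\alpha=\sum_{j=0}^{m_1-1}\alpha_j^dq^{-j}$, $\beta=\sum_{j=0}^{m_2+d-1}\beta_j^dq^{-j}$. Define $$\phi_d(k)=[y(k),\ldots,y(k-m_1+1),u(k-1),\ldots,u(k-m_2-d+1)]^T,$$ $$\vartheta_d^*=[\alpha_0^d,\ldots,\alpha_{m_1-1}^d,\beta_1^d,\ldots,\beta_{m_2+d-1}^d]^T,\quad \Phi_d(k)=\begin{bmatrix}\phi_d(k)\\ u(k)\end{bmatrix},\quad\theta_d^*=\begin{bmatrix}\vartheta_d^*\\ \beta_0^d\end{bmatrix},$$ and $M=m_1+m_2+d$, so $\Phi_d(k),\theta_d^*\in\mathbb{R}^M$. Initial conditions are finite. Zeros of $B(q^{-1})$ are understood in the variable $q$. $\hat\theta_d(k)=[\hat\vartheta_d(k)^T\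 \ \hat\theta_{d,\nu}(k)]^T$ is the estimate of $\theta_d^*$; $\hat\theta_{d,\nu}(k)$ is its last, i.e. $\nu=(m_1+m_2+d)$-th, element, the estimate of $\beta_0^d$. The gain is $a(k)=1$ if the $\nu$-th element of the right-hand side of the update law for $\hat\theta_d(k)$, evaluated using $a(k)=1$, is nonzero; otherwise $a(k)=\gamma_d$, where $0<\gamma_d<2$, $\gamma_d\ne1$. Sufficient richness: a sequence $x(t)\in\mathbb{R}^n$ is sufficiently rich (SR) of order $m$ (in $N$ steps) if there exist a positive integer $N$ and $\alpha>0$ such that $\sum_{t=t_0+1}^{t_0+N}\xi_m(t)\xi_m(t)^T\ge\alpha I$ uniformly for all $t_0$, where $\xi_m(t)$ is the column vector stacking $x(t+1),\ldots,x(t+m)$.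
   Formalization: Richness of order p, even when order p+1 is excluded, makes (ii) false; ''constant order p'' is taken to mean SR of order p and, if p<M, a fixed nonzero c in R^{p+1} with c^T ξ_{p+1}(t)→0 for y_ref. The initial last entry of the estimate is assumed nonzero. *)

(* Defs.v *)
From HB Require Import structures.
From mathcomp Require Import all_boot all_order all_algebra.
From mathcomp Require Import all_classical all_reals all_analysis.
From mathcomp Require Import complex.
From mathcomp Require Import ring.

Set Implicit Arguments.
Unset Strict Implicit.
Unset Printing Implicit Defensive.

Import Order.TTheory GRing.Theory Num.Theory.
Import numFieldNormedType.Exports.

Local Open Scope classical_set_scope.
Local Open Scope ring_scope.

(* A polynomial in q^-1 is a {poly R} whose indeterminate 'X stands for the
   backward shift q^-1.  Signals are functions int -> R: the equations of the
   closed loop are imposed at times k >= 0 only, and the values at negative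
   times are the (arbitrary, finite) initial conditions. *)

(* (P(q^-1) x)(k) *)
Definition qfilter (R : realType) (P : {poly R}) (x : int -> R) (k : int) : R :=
  \sum_(l < size P) P`_l * x (k - l%:Z).

(* A(q^-1) y(k) = q^-d (B(q^-1) u(k) + D(k)) *)
Definition plant (R : realType) (A B : {poly R}) (d : nat) (D u y : int -> R)
    (k : int) : Prop :=
  qfilter A y k = qfilter B u (k - d%:Z) + D (k - d%:Z).

(* The zeros are those in the variable q, hence the evaluation of B at z^-1;
   z = 0, the only zero gained by multiplying B(q^-1) with a power of q, lies
   inside the disk anyway. *)
Definition zeros_inside_unit_disk (R : realType) (B : {poly R}) : Prop :=
  forall z : R[i], z != 0 ->
    (map_poly (real_complex R) B).[z^-1] = 0 -> `|z| < 1.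

Definition bezout_delay (R : realType) (m1 d : nat) (A F alpha : {poly R}) :
    Prop :=
  [/\ (size F <= d)%N, (size alpha <= m1)%N & 1 = F * A + 'X^d * alpha].

Definition phidim (m1 m2 d : nat) : nat := (m1 + (m2 + d).-1)%N.

Definition regdim (m1 m2 d : nat) : nat := (phidim m1 m2 d + 1)%N.

Lemma regdimE (m1 m2 d : nat) : (0 < d)%N -> regdim m1 m2 d = (m1 + m2 + d)%N.
Proof. by case: d => // d _; rewrite /regdim /phidim !addnS addn0 /= addnA. Qed.

Definition phi (R : realType) (m1 m2 d : nat) (y u : int -> R) (k : int) :
    'cV[R]_(phidim m1 m2 d) :=
  col_mx (\col_(i < m1) y (k - i%:Z))
         (\col_(j < (m2 + d).-1) u (k - j.+1%:Z)).

Definition Phi (R : realType) (m1 m2 d : nat) (y u : int -> R) (k : int) :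
    'cV[R]_(regdim m1 m2 d) :=
  col_mx (phi m1 m2 d y u k) (u k)%:M.

Definition vartheta_star (R : realType) (m1 m2 d : nat) (alpha beta : {poly R}) :
    'cV[R]_(phidim m1 m2 d) :=
  col_mx (\col_(i < m1) alpha`_i) (\col_(j < (m2 + d).-1) beta`_j.+1).

Definition theta_star (R : realType) (m1 m2 d : nat) (alpha beta : {poly R}) :
    'cV[R]_(regdim m1 m2 d) :=
  col_mx (vartheta_star m1 m2 d alpha beta) (beta`_0)%:M.

Definition dotv (R : realType) (n : nat) (v w : 'cV[R]_n) : R :=
  (v^T *m w) 0 0.

Definition vartheta_part (R : realType) (m1 m2 d : nat)
    (th : 'cV[R]_(regdim m1 m2 d)) : 'cV[R]_(phidim m1 m2 d) := usubmx th.

(* the last, nu-th, element *)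
Definition nu_part (R : realType) (m1 m2 d : nat)
    (th : 'cV[R]_(regdim m1 m2 d)) : R := dsubmx th 0 0.

Definition controller (R : realType) (m1 m2 d : nat) (yref y u : int -> R)
    (th : int -> 'cV[R]_(regdim m1 m2 d)) (k : int) : Prop :=
  u k = (nu_part (th k))^-1 *
        (yref (k + d%:Z) - dotv (vartheta_part (th k)) (phi m1 m2 d y u k)).

Definition pred_error (R : realType) (m1 m2 d : nat) (y u : int -> R)
    (th : int -> 'cV[R]_(regdim m1 m2 d)) (k : int) : R :=
  y k - dotv (th (k - 1)) (Phi m1 m2 d y u (k - d%:Z)).

(* right-hand side of the update law, as a function of the gain a *)
Definition update_rhs (R : realType) (m1 m2 d : nat) (y u : int -> R)
    (th : int -> 'cV[R]_(regdim m1 m2 d)) (a : R) (k : int) :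
    'cV[R]_(regdim m1 m2 d) :=
  th (k - 1) +
  (a * pred_error y u th k /
     (1 + dotv (Phi m1 m2 d y u (k - d%:Z)) (Phi m1 m2 d y u (k - d%:Z))))
  *: Phi m1 m2 d y u (k - d%:Z).

Definition gain (R : realType) (m1 m2 d : nat) (gamma : R) (y u : int -> R)
    (th : int -> 'cV[R]_(regdim m1 m2 d)) (k : int) : R :=
  if nu_part (update_rhs y u th 1 k) != 0 then 1 else gamma.

Definition estimator (R : realType) (m1 m2 d : nat) (gamma : R)
    (y u : int -> R) (th : int -> 'cV[R]_(regdim m1 m2 d)) (k : int) : Prop :=
  th k = update_rhs y u th (gain gamma y u th k) k.

Definition loewner_le (R : realType) (n : nat) (P Q : 'M[R]_n) : Prop :=
  forall v : 'cV[R]_n, dotv v (P *m v) <= dotv v (Q *m v).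

Definition xi (R : realType) (m : nat) (x : int -> R) (t : nat) : 'cV[R]_m :=
  \col_(i < m) x (t + i.+1)%N%:Z.

Definition sufficiently_rich (R : realType) (m : nat) (x : int -> R) : Prop :=
  exists (N : nat) (a : R), [/\ (0 < N)%N, 0 < a &
    forall t0 : nat,
      loewner_le a%:M
        (\sum_(t0.+1 <= t < (t0 + N).+1) xi m x t *m (xi m x t)^T)].

(* Richness of order p only bounds the order from below.  That the order is p
   "constantly" means that order p+1 is missed along one direction c which does
   not change with time.  (The mere negation of richness of order p+1 would
   allow that direction to drift, as for a sinusoid whose frequency varies ever
   more slowly, and the regressor would then not approach any fixed subspace of
   dimension p.)  Orders are counted up to M, the dimension of the regressor:
   at p = M nothing is required beyond richness of order M. *)
Definition sufficiently_rich_constant (R : realType) (M p : nat)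
    (x : int -> R) : Prop :=
  sufficiently_rich p x /\
  ((p < M)%N -> exists2 c : 'cV[R]_p.+1, c != 0 &
     (fun t : nat => dotv c (xi p.+1 x t)) @ \oo --> (0 : R)).

(* Euclidean distance *)
Definition dist_to (R : realType) (n : nat) (S : set 'cV[R]_n) (v : 'cV[R]_n) :
    R :=
  inf [set Num.sqrt (dotv (v - s) (v - s)) | s in S].

Definition converges_to_set (R : realType) (n : nat) (v : nat -> 'cV[R]_n)
    (S : set 'cV[R]_n) : Prop :=
  (fun k : nat => dist_to S (v k)) @ \oo --> (0 : R).

Definition Omega_bar (R : realType) (m1 m2 d : nat) (y u : int -> R) :
    set 'cV[R]_(regdim m1 m2 d) :=
  [set x | (fun k : nat => dotv (Phi m1 m2 d y u k%:Z) x) @ \oo --> (0 : R)].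
Arguments Omega_bar {R} m1 m2 d y u.

Lemma qfilter_widen (R : realType) (n : nat) (P : {poly R}) x k :
  (size P <= n)%N -> qfilter P x k = \sum_(l < n) P`_l * x (k - l%:Z).
Proof.
move=> hn; rewrite /qfilter.
rewrite (big_ord_widen n (fun l : nat => P`_l * x (k - l%:Z)) hn) big_mkcond /=.
apply: eq_bigr => i _; case: ltnP => // hi.
by rewrite nth_default ?mul0r.
Qed.

Lemma qfilterD (R : realType) (P Q : {poly R}) x k :
  qfilter (P + Q) x k = qfilter P x k + qfilter Q x k.
Proof.
pose n := maxn (size P) (size Q).
rewrite !(@qfilter_widen _ n) ?leq_maxl ?leq_maxr ?size_polyD // -big_split /=.
by apply: eq_bigr => i _; rewrite coefD mulrDl.
Qed.

Lemma qfilterZ (R : realType) a (P : {poly R}) x k :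
  qfilter (a *: P) x k = a * qfilter P x k.
Proof.
rewrite (@qfilter_widen _ (size P)) ?size_scale_leq // mulr_sumr.
by apply: eq_bigr => i _; rewrite coefZ mulrA.
Qed.

Lemma qfilterMX (R : realType) (P : {poly R}) x k :
  qfilter (P * 'X) x k = qfilter P x (k - 1).
Proof.
rewrite (@qfilter_widen _ (size P).+1) ?(leq_trans (size_polyMleq _ _)) //; last first.
  by rewrite size_polyX addn2.
rewrite big_ord_recl coefMX eqxx mul0r add0r; apply: eq_bigr => i _.
by rewrite coefMX /= -addrA -opprD -PoszD.
Qed.

Lemma qfilterC (R : realType) (a : R) x k : qfilter a%:P x k = a * x k.
Proof.
by rewrite (@qfilter_widen _ 1) ?size_polyC_leq1 // big_ord1 coefC eqxx subr0.
Qed.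

Lemma qfilterM (R : realType) (P Q : {poly R}) x k :
  qfilter (P * Q) x k = qfilter P (qfilter Q x) k.
Proof.
elim/poly_ind: P k => [|P c IH] k.
  by rewrite mul0r /qfilter size_poly0 !big_ord0.
rewrite mulrDl qfilterD [in RHS]qfilterD qfilterMX -IH qfilterC mul_polyC qfilterZ.
by rewrite -mulrA (mulrC 'X) mulrA qfilterMX.
Qed.

Lemma qfilterXn (R : realType) (n : nat) (P : {poly R}) x k :
  qfilter ('X^n * P) x k = qfilter P x (k - n%:Z).
Proof.
elim: n k => [|n IH] k; first by rewrite mul1r subr0.
rewrite exprS -mulrA mulrC qfilterMX IH; congr (qfilter _ _ _).
by rewrite -addrA -opprD -PoszD.
Qed.

Lemma dotv_col_mx (R : realType) (m n : nat) (a b : 'cV[R]_m) (c e : 'cV[R]_n) :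
  dotv (col_mx a c) (col_mx b e) = dotv a b + dotv c e.
Proof. by rewrite /dotv tr_col_mx mul_row_col mxE. Qed.

Lemma dotv_sum (R : realType) (n : nat) (a b : 'cV[R]_n) :
  dotv a b = \sum_i a i 0 * b i 0.
Proof. by rewrite /dotv mxE; apply: eq_bigr => i _; rewrite mxE. Qed.

(* The d-step-ahead predictor form y(k+d) = vartheta*^T phi(k) + beta_0 u(k) of
   the undisturbed plant. *)
Lemma predictor_form (R : realType) (m1 m2 d : nat) (A B F alpha : {poly R})
    (y u : int -> R) :
  (0 < d)%N -> (size B <= m2.+1)%N -> bezout_delay m1 d A F alpha ->
  (forall k : int, 0 <= k -> plant A B d (fun=> 0) u y k) ->
  forall k : int, 0 <= k ->
    y (k + d%:Z) = dotv (vartheta_star m1 m2 d alpha (F * B)) (phi m1 m2 d y u k)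
                   + (F * B)`_0 * u k.
Proof.
move=> d0 sB [sF sa bez] pl k k0.
have -> : y (k + d%:Z) = qfilter (F * B) u k + qfilter alpha y k.
  have -> : y (k + d%:Z) = qfilter 1 y (k + d%:Z).
    by rewrite -[1]/(1%:P) qfilterC mul1r.
  rewrite bez qfilterD qfilterXn addrK; congr (_ + _).
  rewrite !qfilterM; apply: eq_bigr => l _; congr (_ * _).
  have hl : (l < d)%N by apply: leq_trans sF.
  rewrite pl; last by rewrite -addrA addr_ge0 // subr_ge0 lez_nat ltnW.
  by rewrite addr0; congr (qfilter _ _ _); ring.
rewrite dotv_col_mx (@qfilter_widen _ m1 alpha) //
        (@qfilter_widen _ (m2 + d).-1.+1 (F * B)).
  rewrite big_ord_recl subr0 !dotv_sum [LHS]addrC [in LHS](addrC (_ * u k)) addrA.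
  by congr (_ + _ + _); apply: eq_bigr => i _; rewrite !mxE.
rewrite prednK ?addn_gt0 ?d0 ?orbT //.
apply: leq_trans (size_polyMleq _ _) _.
rewrite -subn1 leq_subLR add1n -addSn addnC.
exact: leq_add.
Qed.

(* Main.v *)
Require Import Defs.
From mathcomp Require Import all_boot all_order all_algebra.
From mathcomp Require Import all_classical all_reals all_analysis.
From mathcomp Require Import complex.
From mathcomp Require Import zify ring lra.
Import Order.TTheory GRing.Theory Num.Theory.
Import numFieldNormedType.Exports.
Local Open Scope classical_set_scope.
Local Open Scope ring_scope.
Set Implicit Arguments.
Unset Strict Implicit.
Unset Printing Implicit Defensive.
Import ComplexField.Normc.

(** The regressor at time k is a linear image of delayed inputs and outputs, and
    the plant is linear in the unknown parameter: y(k+d) = theta0^T Phi(k).  The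
    controller makes the estimated model reproduce the reference, so the tracking
    error is e(k+d) = - (theta(k) - theta0)^T Phi(k), whereas the estimator sees
    the same product with the parameter error taken d-1 steps later.

    Tracking.  With the regressor normalised to length at most one, each update
    decreases the squared length of the parameter error by a fixed multiple of
    the squared normalised prediction error ([normalized_projection]).  Hence the
    normalised prediction error vanishes, successive estimates approach each
    other, and the normalised tracking error vanishes too, the delay d being
    fixed.  Since B(q^-1) u is a filtered output and B is stably invertible, the
    regressor grows at most linearly with the largest past tracking error
    ([regressor_growth]); a tracking error negligible against a quantity bounded
    by its own past maximum is bounded and vanishes ([key_technical]).

    Limit subspaces.  Apply B(q^-1) to the regressor: output entries become
    combinations of outputs, and so do input entries, because B u = A y(. + d).
    Counting delays, only M consecutive outputs occur.  By tracking these may be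
    replaced with M consecutive reference values, and a reference whose richness
    is constantly p obeys asymptotically a recurrence of order p
    ([rich_constant_window]).  So B(q^-1) Phi = G xi_p + o(1) for a constant
    M x p matrix G, where xi_p is the window of p reference values.  Two
    consequences follow.
    - If x^T G = 0 then B(q^-1) (x^T Phi) vanishes, hence so does x^T Phi by
      stability ([kernel_regressor_cvg0]).  Dually Phi approaches the image of G,
      of dimension at most p, and the left kernel of G lies in the limit set of
      the parameter error.
    - The parameter error is asymptotically orthogonal to Phi and changes ever
      more slowly, so it is asymptotically orthogonal to G xi_p along a whole
      window; as xi_p excites every direction, the parameter error approaches the
      left kernel of G ([orthogonal_slow_cvg0]). *)

(** * Vanishing sequences *)

Lemma cvg0D (R : realType) (a b : nat -> R) :
  a @ \oo --> 0 -> b @ \oo --> 0 -> (fun n => a n + b n) @ \oo --> 0.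
Proof.
move=> a0 b0; have h : (fun n => a n + b n) @ \oo --> (0 + 0 : R) by exact: cvgD.
by rewrite addr0 in h.
Qed.

Lemma cvg0Ml (R : realType) (c : R) (a : nat -> R) :
  a @ \oo --> 0 -> (fun n => c * a n) @ \oo --> 0.
Proof.
move=> a0; have h : (fun n => c * a n) @ \oo --> (c * 0 : R) by exact: cvgMr.
by rewrite mulr0 in h.
Qed.

Lemma near_le_cvg0 (R : realType) (a b : nat -> R) (N : nat) :
  (forall n, (N <= n)%N -> `|a n| <= b n) -> b @ \oo --> 0 -> a @ \oo --> 0.
Proof.
move=> ab b0; apply: norm_cvg0.
apply: (@squeeze_cvgr _ _ _ _ (fun=> 0) b) => //; last exact: cvg_cst.
by near=> n; rewrite normr_ge0 ab //; near: n; exists N.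
Unshelve. all: by end_near. Qed.

Lemma cvg0_bounded (R : realType) (a : nat -> R) (l : R) :
  a @ \oo --> l -> exists K, forall n, `|a n| <= K.
Proof.
move=> al; have [|M [_ hM]] := @cvg_seq_bounded _ _ a.
  by apply/cvg_ex; exists l.
exists (M + 1) => n; apply: hM => //; lra.
Qed.

Lemma cvg0M_bounded (R : realType) (a b : nat -> R) (K : R) :
  a @ \oo --> 0 -> (forall n, `|b n| <= K) ->
  (fun n => a n * b n) @ \oo --> 0.
Proof.
move=> a0 bK; apply: (@near_le_cvg0 _ _ (fun n => `|a n| * K) 0) => [n _|].
  by rewrite normrM ler_wpM2l.
under eq_fun do rewrite mulrC; apply: cvg0Ml.
by apply/norm_cvg0P.
Qed.

Lemma cvg0_sum (R : realType) (I : Type) (r : seq I) (P : pred I)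
    (f : I -> nat -> R) :
  (forall i, f i @ \oo --> 0) ->
  (fun n => \sum_(i <- r | P i) f i n) @ \oo --> 0.
Proof.
move=> f0; elim: r => [|i r IH].
  by under eq_fun do rewrite big_nil; exact: cvg_cst.
under eq_fun do rewrite big_cons.
case: (P i) => //.
exact: cvg0D.
Qed.

Lemma cvg0_subseq (R : realType) (a : nat -> R) (s : nat -> nat) (l : R) :
  (forall n, (n <= s n)%N) -> a @ \oo --> l -> (a \o s) @ \oo --> l.
Proof.
move=> hs al; apply: cvg_comp al => P [N _ NP]; exists N => // n /= Nn.
by apply: NP; rewrite /= (leq_trans Nn).
Qed.

(** * Stable inversion of a filter with zeros inside the unit disk *)

(** The geometric series bound for one first-order factor, on a finite horizon:
    in the closed loop the input of the filter is controlled up to the current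
    time only. *)
Lemma contraction_bounded (R : realType) (rho W : R) (a : nat -> R) (n : nat) :
  0 <= rho < 1 -> 0 <= W -> 0 <= a 0%N ->
  (forall k, (k < n)%N -> a k.+1 <= rho * (a k + W)) ->
  forall k, (k <= n)%N -> a k <= a 0%N + W / (1 - rho).
Proof.
move=> /andP[r0 r1] W0 a0 ha.
have h1 : 0 < 1 - rho by lra.
have hW : W = (1 - rho) * (W / (1 - rho)) by rewrite mulrC divfK // gt_eqF.
have hW0 : 0 <= W / (1 - rho) by rewrite divr_ge0 // ltW.
move: (W / (1 - rho)) hW hW0 => V -> V0 in ha *.
elim=> [|k IH] kn; first lra.
have h2 := ha _ kn; have h3 := IH (ltnW kn).
have h4 : 0 <= rho * (a 0%N + V - a k) by rewrite mulr_ge0 // subr_ge0.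
have h5 : 0 <= (1 - rho) ^+ 2 * V by rewrite mulr_ge0 // sqr_ge0.
have h6 : 0 <= (1 - rho) * a 0%N by rewrite mulr_ge0 // ltW.
nra.
Qed.

Lemma contraction_cvg0 (R : realType) (rho : R) (a w : nat -> R) :
  0 <= rho < 1 -> (forall n, 0 <= a n) ->
  (forall n, a n.+1 <= rho * (a n + w n)) ->
  w @ \oo --> 0 -> a @ \oo --> 0.
Proof.
move=> /andP[r0 r1] a0 ha w0.
have h1 : 0 < 1 - rho by lra.
apply/cvgr0Pnorm_le => e e0.
have e1 : 0 < e / 2 * (1 - rho) by apply: mulr_gt0 => //; lra.
move/cvgr0Pnorm_le : w0 => /(_ _ e1)[N _ hN].
have bnd : forall m, a (N + m)%N <= rho ^+ m * a N + e / 2.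
  elim=> [|m IH]; first by rewrite addn0 expr0; lra.
  rewrite addnS exprS; apply: le_trans (ha _) _.
  have := hN (N + m)%N (leq_addr _ _); rewrite ler_norml => /andP[_ hw].
  by nra.
have e2 : 0 < e / 2 by lra.
have /cvgr0Pnorm_le/(_ _ e2)[N' _ hN'] : (fun m => rho ^+ m * a N) @ \oo --> 0.
  under eq_fun do rewrite mulrC.
  by apply: cvg0Ml; apply: cvg_expr; rewrite ger0_norm.
exists (N + N')%N => // n /= hn; rewrite ger0_norm //.
have nE : n = (N + (n - N))%N by lia.
rewrite nE; apply: le_trans (bnd _) _.
have /hN' : (N' <= n - N)%N by lia.
by rewrite ger0_norm ?mulr_ge0 ?exprn_ge0 // => ?; lra.
Qed.

(** The filter over any commutative ring: B splits into first-order factors over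
    the complex numbers only. *)
Definition cfilter (K : comNzRingType) (P : {poly K}) (x : int -> K) (k : int) : K :=
  \sum_(l < size P) P`_l * x (k - l%:Z).

Lemma cfilter_widen (K : comNzRingType) (n : nat) (P : {poly K}) x k :
  (size P <= n)%N -> cfilter P x k = \sum_(l < n) P`_l * x (k - l%:Z).
Proof.
move=> hn; rewrite /cfilter.
rewrite (big_ord_widen n (fun l : nat => P`_l * x (k - l%:Z)) hn) big_mkcond /=.
apply: eq_bigr => i _; case: ltnP => // hi.
by rewrite nth_default ?mul0r.
Qed.

Lemma cfilter_mulXsubC (K : comNzRingType) (z : K) (P : {poly K}) x k :
  cfilter (('X - z%:P) * P) x k = cfilter P x (k - 1) - z * cfilter P x k.
Proof.
have hs : (size (('X - z%:P) * P)%R <= (size P).+1)%N.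
  by rewrite (leq_trans (size_polyMleq _ _)) // size_XsubC.
rewrite (cfilter_widen _ _ hs) [in X in z * X](@cfilter_widen _ (size P).+1) //.
have -> : cfilter P x (k - 1) = \sum_(l < (size P).+1) ('X * P)`_l * x (k - l%:Z).
  rewrite big_ord_recl coefXM eqxx mul0r add0r; apply: eq_bigr => i _.
  by rewrite coefXM /= -addrA -opprD -PoszD.
rewrite mulr_sumr -sumrB; apply: eq_bigr => i _.
by rewrite mulrBl coefB coefCM mulrBl mulrA.
Qed.

(** The first clause is on a finite horizon because the adaptive loop bounds the
    filtered signal in terms of its own past; the constant K may depend on the
    signal, so as to absorb its initial conditions. *)
Definition stable (R : realType) (P : {poly R[i]}) : Prop :=
  forall x : int -> R[i],
  (exists K : R, 0 <= K /\ forall (n : nat) (W : R), 0 <= W ->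
     (forall k, (k <= n)%N -> normc (cfilter P x k%:Z) <= W) ->
     forall k, (k <= n)%N -> normc (x k%:Z) <= K * (1 + W)) /\
  ((fun k : nat => normc (cfilter P x k%:Z)) @ \oo --> (0 : R) ->
   (fun k : nat => normc (x k%:Z)) @ \oo --> (0 : R)).

Lemma normc_ge0 (R : realType) (z : R[i]) : 0 <= normc z.
Proof. by case: z => a b; exact: sqrtr_ge0. Qed.

Lemma normc_real (R : realType) (a : R) : normc (a%:C)%C = `|a|.
Proof. by rewrite /= expr0n addr0 sqrtr_sqr. Qed.

Lemma stable_const (R : realType) (c : R[i]) : c != 0 -> stable c%:P.
Proof.
move=> c0 x.
have E k : cfilter c%:P x k = c * x k.
  by rewrite (@cfilter_widen _ 1) ?size_polyC_leq1 // big_ord1 coefC eqxx subr0.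
have nc : normc c != 0 by apply: contra c0 => /eqP/eq0_normc ->.
have nx k : normc (x k) = (normc c)^-1 * normc (cfilter c%:P x k).
  by rewrite E normcM mulKf.
have ic : 0 <= (normc c)^-1 by rewrite invr_ge0 normc_ge0.
split.
  exists (normc c)^-1; split=> // n W W0 h k kn.
  by rewrite nx ler_wpM2l // (le_trans (h k kn)) // lerDr.
move=> h; under eq_fun do rewrite nx.
exact: cvg0Ml.
Qed.

(** The output v of P satisfies v(k) = (v(k-1) - w(k)) / z when w is the output of
    the product: a contraction of v when |z| > 1. *)
Lemma stable_mulXsubC (R : realType) (z : R[i]) (P : {poly R[i]}) :
  1 < normc z -> stable P -> stable (('X - z%:P) * P).
Proof.
move=> z1 sP x; have [[K [K0 hK]] hP] := sP x.
pose v k := cfilter P x k; pose w k := cfilter (('X - z%:P) * P) x k.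
pose rho := (normc z)^-1.
have z0 : z != 0 by apply: contraTneq z1 => ->; rewrite normc0 -leNgt.
have r0 : 0 <= rho by rewrite invr_ge0 normc_ge0.
have r1 : rho < 1 by rewrite invf_lt1 // (lt_trans ltr01).
have r01 : 0 <= rho < 1 by rewrite r0.
have vE k : v k = z^-1 * (v (k - 1) - w k).
  by rewrite /w cfilter_mulXsubC opprB addrC subrK mulKf.
have step k : normc (v k) <= rho * (normc (v (k - 1)) + normc (w k)).
  rewrite {1}vE normcM normcV ler_wpM2l //.
  by apply: le_trans (le_normcD _ _) _; rewrite normcN.
pose a (k : nat) := normc (v (k%:Z - 1)).
have aS k : a k.+1 = normc (v k%:Z) by rewrite /a -addn1 PoszD addrK.
have ha k : a k.+1 <= rho * (a k + normc (w k%:Z)) by rewrite aS step.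
have a0 k : 0 <= a k by exact: normc_ge0.
split.
  have h1 : 0 < 1 - rho by lra.
  have i1 : 0 <= (1 - rho)^-1 by rewrite invr_ge0 ltW.
  exists (K * (1 + a 0%N + (1 - rho)^-1)); split; first by rewrite mulr_ge0 // !addr_ge0.
  move=> n W W0 hW k kn.
  have hv j : (j <= n)%N -> normc (v j%:Z) <= a 0%N + W / (1 - rho).
    move=> jn; rewrite -aS; apply: (contraction_bounded (n := n.+1)) => // i ni.
    by rewrite (le_trans (ha _)) // ler_wpM2l // lerD2l hW.
  apply: le_trans (hK n (a 0%N + W / (1 - rho)) _ hv k kn) _.
    by rewrite addr_ge0 // mulr_ge0.
  rewrite -mulrA ler_wpM2l //; have := a0 0%N => ?; nra.
move=> hw; apply: hP.
have := contraction_cvg0 r01 a0 ha hw; rewrite -cvg_shiftS.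
by under eq_fun do rewrite aS.
Qed.

Lemma stable_prod (R : realType) (c : R[i]) (s : seq R[i]) :
  c != 0 -> (forall z, z \in s -> 1 < normc z) ->
  stable (c *: \prod_(z <- s) ('X - z%:P)).
Proof.
move=> c0; elim: s => [|z s IH] hs.
  by rewrite big_nil alg_polyC; exact: stable_const.
rewrite big_cons scalerAr; apply: stable_mulXsubC.
  by apply: hs; rewrite mem_head.
by apply: IH => t ts; apply: hs; rewrite inE ts orbT.
Qed.

(** The roots of B in the indeterminate q^-1 are the inverses of the zeros in q, so
    they lie outside the closed disk and each contributes a stable factor. *)
Lemma zeros_inside_unit_disk_stable (R : realType) (B : {poly R}) :
  B`_0 != 0 -> zeros_inside_unit_disk B -> stable (map_poly (real_complex R) B).
Proof.
move=> B0 hz; set P := map_poly _ B.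
have [s Ps] := closed_field_poly_normal P.
have P0 : P != 0 by rewrite map_poly_eq0; apply: contraNneq B0 => ->; rewrite coef0.
rewrite Ps; apply: stable_prod; first by rewrite lead_coef_eq0.
move=> z zs.
have Pz : P.[z] = 0.
  apply/eqP; rewrite -[_ == _]/(root P z) Ps rootZ ?lead_coef_eq0 //.
  by rewrite root_prod_XsubC.
have z0 : z != 0.
  apply: contraNneq B0 => z0; move: Pz; rewrite z0 horner_coef0 coef_map /=.
  by move=> /eqP; rewrite fmorph_eq0.
have := hz z^-1; rewrite invr_eq0 invrK => /(_ z0 Pz).
rewrite -[`|_|]/(normc z^-1)%:C%C ltcR normcV invf_lt1 //.
rewrite lt_def normc_ge0 andbT; apply: contra z0 => /eqP/eq0_normc -> //.
Qed.

Lemma cfilter_map_real (R : realType) (B : {poly R}) (x : int -> R) k :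
  cfilter (map_poly (real_complex R) B) (fun j => real_complex R (x j)) k =
  real_complex R (qfilter B x k).
Proof.
rewrite /qfilter rmorph_sum (@cfilter_widen _ (size B)) ?size_poly //.
by apply: eq_bigr => l _; rewrite coef_map rmorphM.
Qed.

Lemma stable_qfilter_bounded (R : realType) (B : {poly R}) (x : int -> R) :
  B`_0 != 0 -> zeros_inside_unit_disk B ->
  exists K : R, 0 <= K /\ forall (n : nat) (W : R), 0 <= W ->
     (forall k, (k <= n)%N -> `|qfilter B x k%:Z| <= W) ->
     forall k, (k <= n)%N -> `|x k%:Z| <= K * (1 + W).
Proof.
move=> B0 hz.
have [[K [K0 hK]] _] :=
  zeros_inside_unit_disk_stable B0 hz (fun j => real_complex R (x j)).
exists K; split=> // n W W0 h k kn; rewrite -normc_real; apply: (hK n) => // j jn.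
by rewrite cfilter_map_real normc_real h.
Qed.

Lemma stable_qfilter_cvg0 (R : realType) (B : {poly R}) (x : int -> R) :
  B`_0 != 0 -> zeros_inside_unit_disk B ->
  (fun k : nat => qfilter B x k%:Z) @ \oo --> (0 : R) ->
  (fun k : nat => x k%:Z) @ \oo --> (0 : R).
Proof.
move=> B0 hz h.
have [_ hc] :=
  zeros_inside_unit_disk_stable B0 hz (fun j => real_complex R (x j)).
apply: norm_cvg0; under eq_fun do rewrite -normc_real; apply: hc.
under eq_fun do rewrite cfilter_map_real normc_real.
by apply/norm_cvg0P.
Qed.

(** * Inner products *)

Lemma dotvDl (R : realType) (n : nat) (a b c : 'cV[R]_n) :
  dotv (a + b) c = dotv a c + dotv b c.
Proof. by rewrite /dotv linearD mulmxDl mxE. Qed.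

Lemma dotvZl (R : realType) (n : nat) (k : R) (a b : 'cV[R]_n) :
  dotv (k *: a) b = k * dotv a b.
Proof. by rewrite /dotv linearZ -scalemxAl mxE. Qed.

Lemma dotvC (R : realType) (n : nat) (a b : 'cV[R]_n) : dotv a b = dotv b a.
Proof. by rewrite !dotv_sum; apply: eq_bigr => i _; rewrite mulrC. Qed.

Lemma dotvDr (R : realType) (n : nat) (a b c : 'cV[R]_n) :
  dotv c (a + b) = dotv c a + dotv c b.
Proof. by rewrite dotvC dotvDl !(dotvC _ c). Qed.

Lemma dotvZr (R : realType) (n : nat) (k : R) (a b : 'cV[R]_n) :
  dotv a (k *: b) = k * dotv a b.
Proof. by rewrite dotvC dotvZl dotvC. Qed.

Lemma dotvBl (R : realType) (n : nat) (a b c : 'cV[R]_n) :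
  dotv (a - b) c = dotv a c - dotv b c.
Proof. by rewrite -scaleN1r dotvDl dotvZl mulN1r. Qed.

Lemma sqr_entry_le_dotv (R : realType) (n : nat) (a : 'cV[R]_n) i :
  a i 0 ^+ 2 <= dotv a a.
Proof.
rewrite dotv_sum (bigD1 i) //= -expr2 lerDl.
by apply: sumr_ge0 => j _; rewrite -expr2 sqr_ge0.
Qed.

Lemma dotv_ge0 (R : realType) (n : nat) (a : 'cV[R]_n) : 0 <= dotv a a.
Proof. by rewrite dotv_sum sumr_ge0 // => i _; rewrite -expr2 sqr_ge0. Qed.

Lemma dotv_cvg0 (R : realType) (n : nat) (a b : nat -> 'cV[R]_n) (K : R) :
  (forall i, (fun t => a t i 0) @ \oo --> 0) ->
  (forall t i, `|b t i 0| <= K) ->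
  (fun t => dotv (a t) (b t)) @ \oo --> 0.
Proof.
move=> a0 bK; under eq_fun do rewrite dotv_sum.
by apply: cvg0_sum => i; apply: cvg0M_bounded => // t; apply: bK.
Qed.

(** The estimates need not converge: only increments over a fixed number of steps
    vanish. *)
Lemma slow_drift (R : realType) (n : nat) (Th : nat -> 'cV[R]_n) (i : 'I_n) :
  (fun t => Th t.+1 i 0 - Th t i 0) @ \oo --> 0 ->
  forall j, (fun t => Th (t + j)%N i 0 - Th t i 0) @ \oo --> 0.
Proof.
move=> h; elim=> [|j IH].
  under eq_fun do rewrite addn0 subrr; exact: cvg_cst.
have h' := cvg0_subseq (s := fun t => (t + j)%N) (leq_addr j) h.
have := cvg0D h' IH; apply: cvg_trans; apply: near_eq_cvg; near=> t.
by rewrite addnS /=; ring.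
Unshelve. all: by end_near. Qed.

(** * The normalised projection algorithm *)

(** Here f is the normalised regressor and d' the number of steps between the use
    of an estimate and its correction.  The squared length of Th is a Lyapunov
    function: an update of gain a lowers it by at least a (2 - a) times the
    squared prediction error, so its convergence makes the prediction error
    vanish. *)
Lemma normalized_projection (R : realType) (m d' : nat) (Th f : nat -> 'cV[R]_m)
    (a : nat -> R) (del : R) :
  0 < del ->
  (forall n, 0 <= a n <= 2 /\ del <= a n * (2 - a n)) ->
  (forall n, dotv (f n) (f n) <= 1) ->
  (forall n, Th (n + d').+1 =
     Th (n + d')%N - (a n * dotv (Th (n + d')%N) (f n)) *: f n) ->
  [/\ exists K, forall n i, `|Th n i 0| <= K,
      forall i, (fun n => Th n.+1 i 0 - Th n i 0) @ \oo --> 0 &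
      (fun n => dotv (Th n) (f n)) @ \oo --> 0].
Proof.
move=> del0 ha hf hTh.
pose eps n := dotv (Th (n + d')%N) (f n).
pose V n := dotv (Th (n + d')%N) (Th (n + d')%N).
have V0 n : 0 <= V n by exact: dotv_ge0.
have VS n : V n.+1 <= V n - del * eps n ^+ 2.
  have [a02 ad] := ha n.
  rewrite /V addSn hTh -/(eps n) -scaleNr !(dotvDl, dotvDr, dotvZl, dotvZr).
  rewrite (dotvC (f n)) -/(eps n).
  (* Expanding the square leaves a^2 |f|^2 - 2 a, at most - a (2 - a). *)
  have h1 : 0 <= (a n * eps n) ^+ 2 * (1 - dotv (f n) (f n)).
    by rewrite mulr_ge0 ?sqr_ge0 // subr_ge0.
  have h2 : 0 <= (a n * (2 - a n) - del) * eps n ^+ 2.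
    by rewrite mulr_ge0 ?sqr_ge0 // subr_ge0.
  by nra.
have Vcvg : cvgn V.
  apply: nonincreasing_is_cvgn; last by exists 0 => _ [n _ <-].
  apply/nonincreasing_seqP => n; apply: le_trans (VS n) _.
  by rewrite gerBl mulr_ge0 ?sqr_ge0 // ltW.
have Vd : (fun n => V n - V n.+1) @ \oo --> 0.
  have h1 : V @ \oo --> limn V by [].
  have h2 : (fun n => V n.+1) @ \oo --> limn V by rewrite cvg_shiftS.
  have h3 : (fun n => V n - V n.+1) @ \oo --> (limn V - limn V : R) by exact: cvgB.
  by rewrite subrr in h3.
have eps2 : (fun n => eps n ^+ 2) @ \oo --> 0.
  apply: (@near_le_cvg0 _ _ (fun n => del^-1 * (V n - V n.+1)) 0) => [n _|].
    rewrite ger0_norm ?sqr_ge0 // -ler_pdivrMl ?invr_gt0 // invrK.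
    by have := VS n; lra.
  exact: cvg0Ml.
(* Only the square of eps is controlled so far. *)
have eps0 : eps @ \oo --> 0.
  apply/cvgr0Pnorm_le => e e0; move/cvgr0Pnorm_le : eps2 => /(_ (e ^+ 2)).
  move=> /(_ (exprn_gt0 _ e0)); apply: filterS => n.
  by rewrite normrX ler_pXn2r // nnegrE // ltW.
have f1 n i : `|f n i 0| <= 1.
  rewrite -(@ler_pXn2r _ 2) ?nnegrE // expr1n real_normK ?num_real //.
  exact: le_trans (sqr_entry_le_dotv _ _) _.
have Thd i : (fun n => Th n.+1 i 0 - Th n i 0) @ \oo --> 0.
  rewrite -(cvg_shiftn d').
  apply: (@near_le_cvg0 _ _ (fun n => 2 * `|eps n|) 0) => [n _|].
    rewrite /= hTh !mxE addrAC subrr add0r normrN normrM normrM -/(eps n).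
    have [/andP[a0 a2] _] := ha n.
    rewrite (ger0_norm a0) -[leRHS]mulr1; apply: ler_pM => //.
      by rewrite mulr_ge0.
    by rewrite ler_wpM2r.
  by apply: cvg0Ml; apply/norm_cvg0P.
split=> //.
  have : (fun n => dotv (Th n) (Th n)) @ \oo --> limn V.
    by rewrite -(cvg_shiftn d').
  move=> /cvg0_bounded[K hK]; exists (1 + K) => n i.
  have := hK n; rewrite ger0_norm ?dotv_ge0 // => h1.
  have := sqr_entry_le_dotv (Th n) i; rewrite -real_normK ?num_real // => h2.
  have := normr_ge0 (Th n i 0) => h3; nra.
have h4 : (fun n => dotv (Th (n + d')%N - Th n) (f n)) @ \oo --> 0.
  apply: (dotv_cvg0 (K := 1)) => // i.
  by under eq_fun do rewrite !mxE; apply: slow_drift.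
have := cvg0D eps0 (cvg0Ml (-1) h4); apply: cvg_trans; apply: near_eq_cvg.
by near=> n; rewrite dotvBl /eps; ring.
Unshelve. all: by end_near. Qed.

(** * Boundedness from a negligible error *)

(** If, late enough, rho(n) were governed by an error |e(n)| larger than every
    earlier one, then |e(n)| would be at most half of 1 + |e(n)|, that is at most
    1.  So e, and with it
    rho, is bounded, and then e = O(del). *)
Lemma key_technical (R : realType) (e rho del : nat -> R) (C : R) :
  0 <= C -> del @ \oo --> 0 -> (forall n, 0 <= rho n) ->
  (forall n, `|e n| <= rho n * `|del n|) ->
  (forall n Q, 0 <= Q -> (forall j, (j <= n)%N -> `|e j| <= Q) ->
     rho n <= C * (1 + Q)) ->
  (exists K, forall n, rho n <= K) /\ e @ \oo --> 0.
Proof.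
move=> C0 d0 r0 he hr.
suff [K hK] : exists K, forall n, rho n <= K.
  split; first by exists K.
  apply: (@near_le_cvg0 _ _ (fun n => K * `|del n|) 0) => [n _|].
    by rewrite (le_trans (he n)) // ler_wpM2r.
  by apply: cvg0Ml; apply/norm_cvg0P.
(* The threshold on del which makes rho(n) |del(n)| at most (1 + Q) / 2. *)
have c0 : 0 < (2 * (C + 1))^-1 by rewrite invr_gt0; lra.
move/cvgr0Pnorm_le : (d0) => /(_ _ c0)[N _ hN].
pose Q := 1 + \sum_(j < N) `|e j|.
have Q1 : 1 <= Q by rewrite lerDl sumr_ge0.
suff bnd : forall n j, (j < n)%N -> `|e j| <= Q.
  exists (C * (1 + Q)) => n; apply: hr; first lra.
  by move=> j _; apply: (bnd j.+1).
elim=> [//|n IH] j; rewrite ltnS leq_eqVlt => /orP[/eqP->{j}|]; last exact: IH.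
(* Errors before time N are bounded by their sum, included in Q. *)
have [nN|Nn] := ltnP n N.
  rewrite /Q (bigD1 (Ordinal nN)) //=.
  have : 0 <= \sum_(i < N | i != Ordinal nN) `|e i| by rewrite sumr_ge0.
  by lra.
rewrite leNgt; apply/negP => eQ.
have h1 : rho n <= C * (1 + `|e n|).
  apply: hr => // j; rewrite leq_eqVlt => /orP[/eqP-> //|jn].
  by rewrite (le_trans (IH _ jn)) // ltW.
have h2 : rho n * `|del n| <= C * (1 + `|e n|) * (2 * (C + 1))^-1.
  by rewrite ler_pM // hN.
have h3 : C * (1 + `|e n|) * (2 * (C + 1))^-1 <= (1 + `|e n|) / 2.
  rewrite ler_pdivrMr; last lra.
  by have := normr_ge0 (e n) => h; nra.
have := he n; lra.
Qed.

(** * Sufficient richness *)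

(** Summing the squares of the inner products over one richness window gives the
    quadratic form of the Gram matrix at v(t), which dominates the squared length
    of v(t). *)
Lemma rich_excitation_cvg0 (R : realType) (p : nat) (x : int -> R)
    (v : nat -> 'cV[R]_p) :
  sufficiently_rich p x ->
  (forall j, (fun t => dotv (v t) (xi p x (t + j)%N)) @ \oo --> 0) ->
  forall i, (fun t => v t i 0) @ \oo --> 0.
Proof.
move=> [N [a [_ a0 hN]]] hv i.
pose S t := \sum_(j < N) dotv (v t) (xi p x (t + j.+1)%N) ^+ 2.
have S0 : S @ \oo --> 0.
  apply: cvg0_sum => j; have [K hK] := cvg0_bounded (hv j.+1).
  by under eq_fun do rewrite expr2; apply: cvg0M_bounded.
have vS t : v t i 0 ^+ 2 <= a^-1 * S t.
  rewrite ler_pdivlMl //; apply: le_trans (_ : a * dotv (v t) (v t) <= _).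
    by rewrite ler_pM2l // sqr_entry_le_dotv.
  have := hN t (v t); rewrite mul_scalar_mx dotvZr => /le_trans; apply.
  rewrite -[t.+1]add0n big_addn subSS addKn big_mkord mulmx_suml.
  rewrite /dotv mulmx_sumr summxE /S le_eqVlt; apply/orP; left; apply/eqP.
  apply: eq_bigr => j _; rewrite addnC addSnnS.
  rewrite -mulmxA mulmxA mxE big_ord1 expr2 /dotv; congr (_ * _).
  exact: dotvC.
apply/cvgr0Pnorm_le => e e0.
have e1 : 0 < e ^+ 2 by rewrite exprn_gt0.
move/cvgr0Pnorm_le : (cvg0Ml a^-1 S0) => /(_ _ e1); apply: filterS => t h.
rewrite -(@ler_pXn2r _ 2) ?nnegrE // ?(ltW e0) // real_normK ?num_real //.
by apply: le_trans (vS t) _; apply: le_trans h; exact: ler_norm.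
Qed.

(** Modulo vanishing signals, f lies in the space of signals spanned by the
    current window of x. *)
Definition asymp_window (R : realType) (p : nat) (x : int -> R) (f : nat -> R) :=
  exists g : 'cV[R]_p, (fun t => f t - dotv g (xi p x t)) @ \oo --> 0.

Lemma asymp_window_lin (R : realType) (p : nat) (x : int -> R)
    (I : Type) (r : seq I) (P : pred I) (c : I -> R) (f : I -> nat -> R) :
  (forall i, P i -> asymp_window p x (f i)) ->
  asymp_window p x (fun t => \sum_(i <- r | P i) c i * f i t).
Proof.
move=> hf; elim: r => [|i r [g hg]].
  exists 0; under eq_fun => t.
    rewrite big_nil dotv_sum big1 ?subr0; last by move=> i _; rewrite mxE mul0r.
  over.
  exact: cvg_cst.
case Pi: (P i); last by exists g; under eq_fun do rewrite big_cons Pi.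
have [g' hg'] := hf i Pi; exists (c i *: g' + g).
have := cvg0D (cvg0Ml (c i) hg') hg; apply: cvg_trans; apply: near_eq_cvg.
by near=> t; rewrite big_cons Pi dotvDl dotvZl; ring.
Unshelve. all: by end_near. Qed.

Lemma asymp_window_close (R : realType) (p : nat) (x : int -> R) (f f' : nat -> R) :
  asymp_window p x f -> (fun t => f' t - f t) @ \oo --> 0 -> asymp_window p x f'.
Proof.
move=> [g hg] h; exists g.
have := cvg0D h hg; apply: cvg_trans; apply: near_eq_cvg.
by near=> t; ring.
Unshelve. all: by end_near. Qed.

Lemma cst_cvg0_eq0 (R : realType) (a : R) : (fun _ : nat => a) @ \oo --> 0 -> a = 0.
Proof.
move=> h; apply: (@cvg_unique _ (@Rhausdorff R) (a @[_ --> \oo])) => //.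
exact: cvg_cst.
Qed.

(** Were the last coefficient zero, the relation would bind windows of length p
    already, against richness of order p. *)
Lemma rich_constant_lead (R : realType) (p : nat) (x : int -> R)
    (c : 'cV[R]_p.+1) :
  sufficiently_rich p x -> c != 0 ->
  (fun t : nat => dotv c (xi p.+1 x t)) @ \oo --> 0 -> c ord_max 0 != 0.
Proof.
move=> hx c0 hc; apply: contraNneq c0 => cm.
pose c' : 'cV[R]_p := \col_i c (widen_ord (leqnSn p) i) 0.
(* Both windows start at the same sample, so dropping c_p leaves the same signal. *)
have c'E t : dotv c' (xi p x t) = dotv c (xi p.+1 x t).
  rewrite !dotv_sum big_ord_recr /= cm mul0r addr0.
  by apply: eq_bigr => i _; rewrite !mxE.
have h i : c' i 0 = 0.
  apply: cst_cvg0_eq0; apply: (rich_excitation_cvg0 (v := fun=> c') hx) => j.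
  under eq_fun do rewrite c'E.
  exact: (cvg0_subseq (s := fun t => (t + j)%N) (leq_addr j) hc).
apply/eqP/colP => i; rewrite [RHS]mxE.
have [ip|pi] := ltnP i p; last first.
  by rewrite -cm; congr (c _ _); apply: val_inj => /=; have := ltn_ord i; lia.
have := h (Ordinal ip); rewrite mxE => <-; congr (c _ _).
exact: val_inj.
Qed.

(** Dividing the asymptotic relation of order p + 1 by its last coefficient gives a
    recurrence, by which all later samples reduce to the window of length p.  For
    p = M the window itself covers all n < M. *)
Lemma rich_constant_window (R : realType) (M p : nat) (x : int -> R) (n : nat) :
  sufficiently_rich_constant M p x -> (n < M)%N ->
  asymp_window p x (fun t => x (t + n.+1)%N%:Z).
Proof.
move=> [hx hc]; elim/ltn_ind: n => n IH nM.
have [np|pn] := ltnP n p.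
  exists (\col_i (i == Ordinal np)%:R).
  under eq_fun => t.
    rewrite dotv_sum (bigD1 (Ordinal np)) //= !mxE eqxx mul1r.
    rewrite big1 ?addr0 ?subrr; last by move=> i /negPf; rewrite !mxE => ->; rewrite mul0r.
  over.
  exact: cvg_cst.
have [c c0 cx] := hc (leq_ltn_trans pn nM).
(* Sample n is the last one of the relation shifted by n - p. *)
have cm := rich_constant_lead hx c0 cx.
have := @asymp_window_lin R p x 'I_p (index_enum _) xpredT
  (fun i => - (c ord_max 0)^-1 * c (widen_ord (leqnSn p) i) 0)
  (fun i t => x (t + (n - p + i).+1)%N%:Z).
move=> /(_ _)/asymp_window_close; apply=> [i _|].
  by apply: IH; have := ltn_ord i; lia.
have := cvg0Ml (c ord_max 0)^-1
  (cvg0_subseq (s := fun t => (t + (n - p))%N) (leq_addr _) cx).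
apply: cvg_trans; apply: near_eq_cvg; near=> t.
rewrite /= dotv_sum big_ord_recr /= !mxE mulrDr mulKf // addrC; congr (_ + _).
  by congr x; congr Posz; rewrite /=; lia.
rewrite mulr_sumr -sumrN; apply: eq_bigr => i _.
rewrite !mxE !mulNr opprK mulrA; congr (_ * x _); congr Posz; rewrite /=; lia.
Unshelve. all: by end_near. Qed.

(** * Distance to kernels and images *)

Lemma converges_to_set_close (R : realType) (n : nat) (S : set 'cV[R]_n)
    (v s : nat -> 'cV[R]_n) :
  (forall k, S (s k)) -> (forall i, (fun k => (v k - s k) i 0) @ \oo --> 0) ->
  converges_to_set v S.
Proof.
move=> hS hv; rewrite /converges_to_set.
pose D k := Num.sqrt (dotv (v k - s k) (v k - s k)).
have D0 : D @ \oo --> 0.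
  rewrite -(sqrtr0 R); apply: continuous_cvg; first exact: sqrt_continuous.
  under eq_fun do rewrite dotv_sum.
  apply: cvg0_sum => i; have [K hK] := cvg0_bounded (hv i).
  exact: cvg0M_bounded.
apply: (@near_le_cvg0 _ _ D 0) => // k _.
have lb : lbound [set Num.sqrt (dotv (v k - w) (v k - w)) | w in S] 0.
  by move=> _ [w _ <-]; exact: sqrtr_ge0.
rewrite ger0_norm; first by apply: ge_inf; [exists 0 | exists (s k)].
by apply: lb_le_inf => //; exists (D k), (s k).
Qed.

(** Subtracting v^T C times the pseudo-inverse of C moves v into the left kernel of
    C, by a linear function of v^T C. *)
Lemma converges_to_kernel (R : realType) (n q : nat) (C : 'M[R]_(n, q))
    (S : set 'cV[R]_n) (v : nat -> 'cV[R]_n) :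
  (forall x : 'cV[R]_n, x^T *m C = 0 -> S x) ->
  (forall j, (fun k => ((v k)^T *m C) 0 j) @ \oo --> 0) ->
  converges_to_set v S.
Proof.
move=> hS hv; pose w k := (v k)^T *m C *m pinvmx C.
apply: (@converges_to_set_close _ _ _ _ (fun k => v k - (w k)^T)) => [k|i].
  apply: hS; rewrite linearB /= trmxK mulmxBl mulmxKpV ?subrr //.
  exact: submxMl.
under eq_fun do rewrite opprB addrC subrK !mxE.
apply: cvg0_sum => j; under eq_fun do rewrite mulrC.
exact: cvg0Ml.
Qed.

Lemma vspace_extend (K : fieldType) (vT : vectType K) (U : {vspace vT}) (p : nat) :
  (\dim U <= p <= \dim {:vT})%N -> exists2 W : {vspace vT}, (U <= W)%VS & \dim W = p.
Proof.
move=> /andP[Up pV].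
have dC : \dim (U^C)%VS = (\dim {:vT} - \dim U)%N by rewrite dimv_compl.
pose X := take (p - \dim U) (vbasis (U^C)%VS).
have fX : free X.
  have : free (vbasis (U^C)%VS) by exact: basis_free (vbasisP _).
  by rewrite -{1}(cat_take_drop (p - \dim U) (vbasis (U^C)%VS)) => /catl_free.
have sX : size X = (p - \dim U)%N.
  rewrite size_takel // size_tuple dC; lia.
have XU : (<<X>> <= U^C)%VS.
  apply/span_subvP => v /mem_take; exact: vbasis_mem.
exists (U + <<X>>)%VS; first exact: addvSl.
rewrite dimv_disjoint_sum; last first.
  apply/eqP; rewrite -subv0; apply: subv_trans (capvS (subvv U) XU) _.
  by rewrite capv_compl.
by move: fX; rewrite /free => /eqP ->; rewrite sX; lia.
Qed.

(** The image of G is the left kernel of a cokernel matrix of G^T, whose columns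
    are left-orthogonal to G.  The rank of G may be smaller than p (for the
    regressor, when A and B share a factor or their degrees are overestimated), so
    the image is enlarged to dimension p. *)
Lemma converges_to_image (R : realType) (n p q : nat) (G : 'M[R]_(n, q))
    (v : nat -> 'cV[R]_n) :
  (q <= p <= n)%N ->
  (forall x : 'cV[R]_n, x^T *m G = 0 -> (fun k => dotv (v k) x) @ \oo --> 0) ->
  exists2 Omega : {vspace 'cV[R]_n}, \dim Omega = p &
    converges_to_set v [set w | w \in Omega].
Proof.
move=> /andP[qp pn] hv.
pose h : 'Hom('cV[R]_q, 'cV[R]_n) := linfun (mulmx G).
have dU : (\dim (limg h) <= q)%N.
  have := limg_ker_dim h fullv; rewrite dimvf /= /dim /= muln1; lia.
have [|W UW dW] := @vspace_extend _ _ (limg h) p.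
  by rewrite (leq_trans dU qp) dimvf /= /dim /= muln1.
exists W => //; apply: (@converges_to_kernel _ _ _ (cokermx G^T)) => [x hx|j] /=.
  have /submxP[z xz] : (x^T <= G^T)%MS by rewrite submxE hx.
  apply: (subvP UW); have -> : x = h z^T.
    by rewrite lfunE /= -[LHS]trmxK xz trmx_mul trmxK.
  exact: memv_img (memvf _).
(* Each column of the cokernel matrix is a direction along which v vanishes. *)
have := hv (col j (cokermx G^T)).
have -> : (col j (cokermx G^T))^T *m G = 0.
  rewrite colE trmx_mul -mulmxA -[_^T *m G]trmxK [X in _ *m X^T]trmx_mul trmxK.
  by rewrite mulmx_coker trmx0 mulmx0.
move=> /(_ erefl); apply: cvg_trans; apply: near_eq_cvg; near=> k.
by rewrite dotv_sum mxE; apply: eq_bigr => i _; rewrite !mxE.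
Unshelve. all: by end_near. Qed.

(** * The closed loop *)

Lemma nu_part_linear (R : realType) (m1 m2 d : nat) (v w : 'cV[R]_(regdim m1 m2 d)) c :
  nu_part (v + c *: w) = nu_part v + c * nu_part w.
Proof. by rewrite /nu_part linearD linearZ !mxE. Qed.

(** When the unit gain would annihilate the last component, the gain gamma scales
    that component by 1 - gamma instead. *)
Lemma nu_part_neq0 (R : realType) (m1 m2 d : nat) (gamma : R) (y u : int -> R)
    (th : int -> 'cV[R]_(regdim m1 m2 d)) :
  gamma != 1 -> nu_part (th (- 1)) != 0 ->
  (forall k : int, 0 <= k -> estimator gamma y u th k) ->
  forall n : nat, nu_part (th n%:Z) != 0.
Proof.
move=> g1 h0 hest n.
have step k : 0 <= k -> nu_part (th (k - 1)) != 0 -> nu_part (th k) != 0.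
  move=> k0 hk; rewrite hest // /gain.
  case: ifPn => [//|]; rewrite negbK /update_rhs !nu_part_linear.
  set X := pred_error _ _ _ _; set r := 1 + _; set N := nu_part (Phi _ _ _ _ _ _).
  rewrite mul1r => /eqP h.
  have -> : nu_part (th (k - 1)) + gamma * X / r * N =
            (1 - gamma) * nu_part (th (k - 1)).
    have -> : gamma * X / r * N = gamma * (X / r * N) by rewrite !mulrA.
    have -> : X / r * N = - nu_part (th (k - 1)) by apply/eqP; rewrite -addr_eq0 addrC h.
    ring.
  by rewrite mulf_neq0 // subr_eq0 eq_sym.
elim: n => [|n IH]; first by apply: step => //; rewrite sub0r.
by apply: step => //; rewrite -addn1 PoszD addrK.
Qed.

Lemma dotv_Phi (R : realType) (m1 m2 d : nat) (y u : int -> R)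
    (v : 'cV[R]_(regdim m1 m2 d)) k :
  dotv v (Phi m1 m2 d y u k) =
  dotv (vartheta_part v) (phi m1 m2 d y u k) + nu_part v * u k.
Proof.
rewrite /vartheta_part /nu_part -{1}(vsubmxK v) dotv_col_mx; congr (_ + _).
by rewrite dotv_sum big_ord1 [in X in _ * X]mxE eqxx mulr1n.
Qed.

(** The control law solves the estimated model for the input, which is possible as
    long as the estimated leading coefficient is nonzero. *)
Lemma controller_certainty_equivalence (R : realType) (m1 m2 d : nat)
    (yref y u : int -> R) (th : int -> 'cV[R]_(regdim m1 m2 d)) k :
  nu_part (th k) != 0 -> controller yref y u th k ->
  dotv (th k) (Phi m1 m2 d y u k) = yref (k + d%:Z).
Proof. by move=> h c; rewrite dotv_Phi c mulVKf // addrC subrK. Qed.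

Lemma plant_regression (R : realType) (m1 m2 d : nat) (A B F alpha : {poly R})
    (y u : int -> R) :
  (0 < d)%N -> (size B <= m2.+1)%N -> bezout_delay m1 d A F alpha ->
  (forall k : int, 0 <= k -> plant A B d (fun=> 0) u y k) ->
  forall k : int, 0 <= k ->
    y (k + d%:Z) = dotv (theta_star m1 m2 d alpha (F * B)) (Phi m1 m2 d y u k).
Proof.
move=> d0 sB hF hpl k k0; rewrite (predictor_form d0 sB hF hpl) // dotv_Phi.
by rewrite /vartheta_part /nu_part /theta_star col_mxKu col_mxKd mxE eqxx mulr1n.
Qed.

(** Entries are handled as delayed signals from here on; the last one is u with
    delay 0. *)
Lemma Phi_entry (R : realType) (m1 m2 d : nat) (y u : int -> R) i :
  (0 < d)%N ->
  (exists2 l, (l < m1)%N & forall k, Phi m1 m2 d y u k i 0 = y (k - l%:Z)) \/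
  (exists2 l, (l < m2 + d)%N & forall k, Phi m1 m2 d y u k i 0 = u (k - l%:Z)).
Proof.
move=> d0; case: (split_ordP i) => [j|j] ->; last first.
  right; exists 0%N => [|k]; first lia.
  by rewrite /Phi col_mxEd (ord1 j) mxE eqxx mulr1n subr0.
case: (split_ordP j) => l ->.
  by left; exists l => // k; rewrite /Phi /phi !col_mxEu mxE.
right; exists l.+1 => [|k]; first by have := ltn_ord l; lia.
by rewrite /Phi /phi col_mxEu col_mxEd mxE.
Qed.

Lemma int_range_bounded (R : realType) (f : int -> R) (N : nat) :
  exists C : R, 0 <= C /\ forall k : int, - N%:Z <= k <= N%:Z -> `|f k| <= C.
Proof.
pose s := \sum_(j < N.+1) `|f j%:Z|; pose s' := \sum_(j < N.+1) `|f (- j%:Z)|.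
have s0 : 0 <= s by rewrite sumr_ge0.
have s0' : 0 <= s' by rewrite sumr_ge0.
exists (s + s'); split=> [|k]; first exact: addr_ge0.
case: (intP k) => [|n|n] hk.
- rewrite /s big_ord_recl /=.
  have : 0 <= \sum_(i < N) `|f (bump 0 i)| by rewrite sumr_ge0.
  lra.
- have nN : (n.+1 < N.+1)%N by lia.
  rewrite /s (bigD1 (Ordinal nN)) //=.
  have : 0 <= \sum_(i < N.+1 | i != Ordinal nN) `|f i| by rewrite sumr_ge0.
  lra.
- have nN : (n.+1 < N.+1)%N by lia.
  rewrite /s' (bigD1 (Ordinal nN)) //=.
  have : 0 <= \sum_(i < N.+1 | i != Ordinal nN) `|f (- i%:Z)| by rewrite sumr_ge0.
  lra.
Qed.

Lemma qfilter_le (R : realType) (A : {poly R}) (x : int -> R) (k : int) (W : R) :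
  (forall l, (l < size A)%N -> `|x (k - l%:Z)| <= W) ->
  `|qfilter A x k| <= (\sum_(l < size A) `|A`_l|) * W.
Proof.
move=> h; rewrite /qfilter (le_trans (ler_norm_sum _ _ _)) // mulr_suml.
by apply: ler_sum => l _; rewrite normrM ler_wpM2l // h.
Qed.

(** Outputs up to time n + d differ from the bounded reference by at most Q; the
    inputs up to time n are recovered from B u = A y(. + d) by stable inversion.
    Initial conditions only enter the constant. *)
Lemma regressor_growth (R : realType) (m1 m2 d : nat) (A B : {poly R})
    (yref y u : int -> R) (Cr : R) :
  (0 < d)%N -> (size A <= m1.+1)%N -> B`_0 != 0 -> zeros_inside_unit_disk B ->
  (forall k : int, 0 <= k -> plant A B d (fun=> 0) u y k) ->
  (forall k : int, 0 <= k -> `|yref k| <= Cr) ->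
  exists C : R, 0 <= C /\ forall (n : nat) (Q : R), 0 <= Q ->
    (forall j, (j <= n)%N -> `|y (j + d)%N%:Z - yref (j + d)%N%:Z| <= Q) ->
    forall i, `|Phi m1 m2 d y u n%:Z i 0| <= C * (1 + Q).
Proof.
move=> d0 sA B0 hz hpl hr.
have [Cy [Cy0 hCy]] := int_range_bounded y (m1 + d).
have [Cu [Cu0 hCu]] := int_range_bounded u (m2 + d).
have [K [K0 hK]] := stable_qfilter_bounded u B0 hz.
have Cr0 : 0 <= Cr by apply: le_trans (hr 0 _).
pose C1 := 1 + Cy + Cr; pose a := \sum_(l < size A) `|A`_l|.
have C10 : 0 <= C1 by rewrite /C1; lra.
have a0 : 0 <= a by rewrite sumr_ge0.
have aC : 0 <= a * C1 by rewrite mulr_ge0.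
have KC : 0 <= K * (1 + a * C1) by rewrite mulr_ge0 // addr_ge0.
exists (C1 + Cu + K * (1 + a * C1)); split=> [|n Q Q0 he i].
  by rewrite !addr_ge0.
have CQ : 0 <= (Cy + Cr) * Q by rewrite mulr_ge0 // addr_ge0.
have hY (k : int) : - m1%:Z <= k <= (n + d)%N%:Z -> `|y k| <= C1 * (1 + Q).
  move=> hk; have [kd|dk] := ltP k d%:Z.
    have hk' : - (m1 + d)%N%:Z <= k <= (m1 + d)%N%:Z by clear - hk kd; lia.
    by have := hCy k hk'; rewrite /C1; lra.
  have [j kE] : exists j : nat, k = (j + d)%N%:Z.
    by exists (absz (k - d%:Z)); clear - dk; lia.
  rewrite kE in hk *.
  have jn : (j <= n)%N by clear - hk; lia.
  have r0 : 0 <= (j + d)%N%:Z :> int by [].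
  have h1 := he j jn; have h2 := hr _ r0.
  have h3 := ler_normD (y (j + d)%N%:Z - yref (j + d)%N%:Z) (yref (j + d)%N%:Z).
  by rewrite subrK in h3; rewrite /C1; lra.
have hU k : (k <= n)%N -> `|u k%:Z| <= K * (1 + a * C1) * (1 + Q).
  move=> kn; have aCQ : 0 <= a * C1 * (1 + Q) by rewrite mulr_ge0 //; lra.
  apply: le_trans (hK n _ aCQ _ k kn) _; last first.
    by rewrite -[leRHS]mulrA ler_wpM2l //; lra.
  move=> j jn; have -> : qfilter B u j%:Z = qfilter A y (j%:Z + d%:Z).
    by rewrite hpl ?addr0 ?addrK.
  rewrite -mulrA; apply: qfilter_le => l lA; apply: hY; clear - lA sA jn kn; lia.
have h1 : 0 <= C1 * (1 + Q) by rewrite mulr_ge0 //; lra.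
have h2 : 0 <= K * (1 + a * C1) * (1 + Q) by rewrite mulr_ge0 //; lra.
have h3 : 0 <= Cu * Q by rewrite mulr_ge0.
case: (Phi_entry y u i d0) => [[l lm ->]|[l lm ->]].
  have hk : - m1%:Z <= n%:Z - l%:Z <= (n + d)%N%:Z by clear - lm; lia.
  have := hY _ hk; lra.
have [ln|nl] := leqP l n.
  have -> : n%:Z - l%:Z = (n - l)%N%:Z by clear - ln; lia.
  have := hU (n - l)%N (leq_subr _ _); lra.
have hk : - (m2 + d)%N%:Z <= n%:Z - l%:Z <= (m2 + d)%N%:Z by clear - lm nl; lia.
have := hCu _ hk; lra.
Qed.

Lemma sqrt_dotv_le (R : realType) (n : nat) (v : 'cV[R]_n) (W : R) :
  0 <= W -> (forall i, `|v i 0| <= W) ->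
  Num.sqrt (1 + dotv v v) <= 1 + n%:R * W.
Proof.
move=> W0 hv; have nW : 0 <= n%:R * W by rewrite mulr_ge0.
rewrite -[leRHS]ger0_norm ?addr_ge0 // -sqrtr_sqr ler_sqrt ?sqr_ge0 //.
have : dotv v v <= n%:R * W ^+ 2.
  rewrite dotv_sum mulr_natl -[in leRHS](card_ord n) -sumr_const.
  apply: ler_sum => i _; rewrite -expr2 -real_normK ?num_real //.
  by rewrite ler_pXn2r // nnegrE.
have : n%:R * W ^+ 2 <= (n%:R * W) ^+ 2.
  rewrite exprMn ler_wpM2r ?sqr_ge0 // -natrX ler_nat.
  by case: n {v hv nW} => // n; rewrite expnS leq_pmulr // expn_gt0.
by move=> h1 h2; nra.
Qed.

(** Dividing the regressor by the square root of 1 + |Phi|^2 turns the estimator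
    into the normalised projection algorithm with d' = d - 1.  The same square root
    is the quantity rho of [key_technical]. *)
Lemma adaptive_loop_convergence (R : realType) (m1 m2 d : nat)
    (A B : {poly R}) (gamma : R) (yref y u : int -> R)
    (th : int -> 'cV[R]_(regdim m1 m2 d)) (ths : 'cV[R]_(regdim m1 m2 d)) :
  (0 < d)%N -> (size A <= m1.+1)%N -> B`_0 != 0 -> zeros_inside_unit_disk B ->
  0 < gamma < 2 ->
  (forall k : int, 0 <= k -> plant A B d (fun=> 0) u y k) ->
  (exists C : R, forall k : int, 0 <= k -> `|yref k| <= C) ->
  (forall k : int, 0 <= k -> y (k + d%:Z) = dotv ths (Phi m1 m2 d y u k)) ->
  (forall k : int, 0 <= k -> dotv (th k) (Phi m1 m2 d y u k) = yref (k + d%:Z)) ->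
  (forall k : int, 0 <= k -> estimator gamma y u th k) ->
  [/\ (fun n : nat => y n%:Z - yref n%:Z) @ \oo --> (0 : R),
      exists K, forall (n : nat) i, `|Phi m1 m2 d y u n%:Z i 0| <= K,
      exists K, forall (n : nat) i, `|(th n%:Z - ths) i 0| <= K &
      forall i, (fun n : nat => (th n.+1%:Z - ths) i 0 - (th n%:Z - ths) i 0)
                  @ \oo --> (0 : R)].
Proof.
move=> d0 sA B0 hz /andP[g0 g2] hpl [Cr hr] hy hc hest.
pose Th (n : nat) := th n%:Z - ths; pose F (n : nat) := Phi m1 m2 d y u n%:Z.
pose s n := Num.sqrt (1 + dotv (F n) (F n)).
have r1 n : 1 <= 1 + dotv (F n) (F n) by rewrite lerDl dotv_ge0.
have s1 n : 1 <= s n by rewrite -(sqrtr1 R) ler_sqrt // ltW // (lt_le_trans _ (r1 n)).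
have s0 n : 0 < s n by rewrite (lt_le_trans _ (s1 n)).
have sV n : (s n)^-1 * (s n)^-1 = (1 + dotv (F n) (F n))^-1.
  by rewrite -invfM -expr2 sqr_sqrtr // (le_trans _ (r1 n)).
pose f n := (s n)^-1 *: F n.
pose a (n : nat) := gain gamma y u th (n + d)%N%:Z.
have ha n : a n = 1 \/ a n = gamma by rewrite /a /gain; case: ifP; [left|right].
have err n : y (n + d)%N%:Z - yref (n + d)%N%:Z = - dotv (Th n) (F n).
  by rewrite PoszD hy // -hc // /Th dotvBl opprB.
have rec n : Th (n + d.-1).+1 =
    Th (n + d.-1)%N - (a n * dotv (Th (n + d.-1)%N) (f n)) *: f n.
  have nE : (n + d.-1).+1 = (n + d)%N by lia.
  rewrite nE /Th hest // -/(a n) /update_rhs /pred_error -/(a n).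
  have -> : (n + d)%N%:Z - 1 = (n + d.-1)%N%:Z by lia.
  have -> : (n + d)%N%:Z - d%:Z = n%:Z by lia.
  rewrite -/(F n) [in y _]PoszD hy // -/(F n) -sV /f dotvZr dotvBl scalerA addrAC.
  by congr (_ + _); rewrite -scaleNr; congr (_ *: _); ring.
(* The values of a (2 - a) at the two possible gains a = 1 and a = gamma. *)
pose del := Num.min 1 (gamma * (2 - gamma)).
have del0 : 0 < del by rewrite lt_min ltr01 mulr_gt0 // subr_gt0.
have [||[K hK] hdrift hf] := @normalized_projection R _ d.-1 Th f a del del0 _ _ rec.
- move=> n; case: (ha n) => ->; split.
  + by rewrite ler01 ler1n.
  + by rewrite ge_min; apply/orP; left; lra.
  + by rewrite !ltW.
  + by rewrite ge_min lexx orbT.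
- move=> n; rewrite /f dotvZl dotvZr mulrA sV mulrC ler_pdivrMr ?mul1r ?lerDr //.
  by rewrite (lt_le_trans _ (r1 n)).
have [C [C0 hC]] :=
  regressor_growth m2 (u := u) d0 sA B0 hz hpl hr.
pose m := regdim m1 m2 d.
pose e (n : nat) := y (n + d)%N%:Z - yref (n + d)%N%:Z.
have [||||[Ks hKs] e0] := @key_technical R e s (fun n => dotv (Th n) (f n))
  (1 + m%:R * C) _ hf.
- by rewrite addr_ge0 // mulr_ge0.
- by move=> n; exact: ltW.
- move=> n; rewrite /e err normrN /f dotvZr normrM gtr0_norm ?invr_gt0 //.
  by rewrite mulVKf ?lt0r_neq0.
- move=> n Q Q0 hQ; have CQ : 0 <= C * (1 + Q) by rewrite mulr_ge0 // addr_ge0.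
  apply: le_trans (sqrt_dotv_le CQ (hC n Q Q0 hQ)) _.
  by rewrite [in leRHS]mulrDl mul1r mulrA lerD2r lerDl.
split=> //.
- by rewrite -(cvg_shiftn d).
- exists Ks => n i; apply: le_trans (hKs n).
  rewrite -sqrtr_sqr ler_wsqrtr //.
  by apply: le_trans (sqr_entry_le_dotv (F n) i) _; rewrite lerDr.
- by exists K.
Qed.

(** * The filtered regressor and the limit subspaces *)

(** Filtering by B makes the input entries combinations of outputs.  In output
    entries y(k-j) the total delay is at most (m1 - 1) + m2, in input entries it
    ranges from - d to (m2 - 1) + m1; shifting by m1 + m2 leaves the outputs
    y(t+1), ..., y(t+M). *)
Lemma filtered_regressor_window (R : realType) (m1 m2 d p : nat) (A B : {poly R})
    (yref y u : int -> R) i :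
  (0 < d)%N -> (size A <= m1.+1)%N -> (size B <= m2.+1)%N ->
  (forall k : int, 0 <= k -> plant A B d (fun=> 0) u y k) ->
  (fun n : nat => y n%:Z - yref n%:Z) @ \oo --> (0 : R) ->
  sufficiently_rich_constant (m1 + m2 + d) p yref ->
  asymp_window p yref
    (fun t => qfilter B (fun k => Phi m1 m2 d y u k i 0) (t + (m1 + m2))%N%:Z).
Proof.
move=> d0 sA sB hpl he hrich.
have hw n : (n < m1 + m2 + d)%N -> asymp_window p yref (fun t => y (t + n.+1)%N%:Z).
  move=> /(rich_constant_window hrich)/asymp_window_close; apply.
  exact: (cvg0_subseq (s := fun t => (t + n.+1)%N) (leq_addr _) he).
case: (Phi_entry y u i d0) => [[j jm hPhi]|[j jm hPhi]].
  have := @asymp_window_lin R p yref 'I_(size B) (index_enum _) xpredT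
    (fun l => B`_l) (fun l t => y (t + (m1 + m2 - j - l).-1.+1)%N%:Z).
  move=> /(_ _)/asymp_window_close; apply=> [l _|].
    by apply: hw; have := ltn_ord l; lia.
  apply: (@near_le_cvg0 _ _ (fun=> 0) 0) => [t _|]; last exact: cvg_cst.
  rewrite /qfilter -sumrB big1 ?normr0 // => l _.
  rewrite hPhi; apply/eqP; rewrite subr_eq0; apply/eqP; congr (_ * y _).
  by have := ltn_ord l; lia.
have := @asymp_window_lin R p yref 'I_(size A) (index_enum _) xpredT
  (fun l => A`_l) (fun l t => y (t + (m1 + m2 + d - j - l).-1.+1)%N%:Z).
move=> /(_ _)/asymp_window_close; apply=> [l _|].
  by apply: hw; have := ltn_ord l; lia.
apply: (@near_le_cvg0 _ _ (fun=> 0) 0) => [t _|]; last exact: cvg_cst.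
have -> : qfilter B (fun k => Phi m1 m2 d y u k i 0) (t + (m1 + m2))%N%:Z =
          qfilter A y (t + (m1 + m2 + d - j))%N%:Z.
  rewrite hpl // addr0; apply: eq_bigr => l _; rewrite hPhi; congr (_ * u _); lia.
rewrite /qfilter -sumrB big1 ?normr0 // => l _.
apply/eqP; rewrite subr_eq0; apply/eqP; congr (_ * y _).
by have := ltn_ord l; lia.
Qed.

Section FilteredRegressor.
Variables (R : realType) (n p s : nat) (x : int -> R) (B : {poly R}).
Variables (F : int -> 'cV[R]_n) (G : 'M[R]_(n, p)).

Let filtered i (t : nat) := qfilter B (fun k => F k i 0) (t + s)%N%:Z.
Let residual i (t : nat) := filtered i t - dotv (row i G)^T (xi p x t).
Hypothesis residual_cvg0 : forall i, residual i @ \oo --> 0.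

Let dotv_filtered (v : 'cV[R]_n) t :
  \sum_i v i 0 * filtered i t =
  \sum_i v i 0 * residual i t + dotv (v^T *m G)^T (xi p x t).
Proof.
have -> : dotv (v^T *m G)^T (xi p x t) = \sum_i v i 0 * dotv (row i G)^T (xi p x t).
  rewrite /dotv trmxK -mulmxA mxE; apply: eq_bigr => i _.
  by rewrite trmxK -row_mul !mxE.
rewrite -big_split; apply: eq_bigr => i _.
by rewrite /= /residual -mulrDr subrK.
Qed.

(** The filtered signal v^T F is asymptotically v^T G times a window, which is zero;
    stable inversion removes the filter. *)
Lemma kernel_regressor_cvg0 (v : 'cV[R]_n) :
  B`_0 != 0 -> zeros_inside_unit_disk B -> v^T *m G = 0 ->
  (fun k : nat => dotv (F k%:Z) v) @ \oo --> (0 : R).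
Proof.
move=> B0 hz vG.
apply: (@stable_qfilter_cvg0 _ B (fun k => dotv (F k) v)) => //.
rewrite -(cvg_shiftn s).
have : (fun t => \sum_i v i 0 * residual i t) @ \oo --> 0.
  by apply: cvg0_sum => i; exact: cvg0Ml.
apply: cvg_trans; apply: near_eq_cvg; near=> t.
have w0 : dotv (v^T *m G)^T (xi p x t) = 0.
  by rewrite vG dotv_sum big1 // => i _; rewrite !mxE mul0r.
have := dotv_filtered v t; rewrite w0 addr0 => <-.
rewrite /filtered /qfilter.
under eq_bigr do rewrite mulr_sumr.
rewrite exchange_big; apply: eq_bigr => l _ /=.
by rewrite dotv_sum mulr_sumr; apply: eq_bigr => i _; ring.
Unshelve. all: by end_near. Qed.

(** A slowly varying Th that is asymptotically orthogonal to the current F is also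
    asymptotically orthogonal to any fixed shift of F, hence to the filtered F and
    to G times every nearby window; richness then gives Th^T G -> 0. *)
Lemma orthogonal_slow_cvg0 (Th : nat -> 'cV[R]_n) (K K' : R) :
  (size B <= s.+1)%N -> sufficiently_rich p x ->
  (forall (k : nat) i, `|F k%:Z i 0| <= K) ->
  (forall k i, `|Th k i 0| <= K') ->
  (forall i, (fun k => Th k.+1 i 0 - Th k i 0) @ \oo --> (0 : R)) ->
  (fun k : nat => dotv (Th k) (F k%:Z)) @ \oo --> (0 : R) ->
  forall j, (fun k => ((Th k)^T *m G) 0 j) @ \oo --> (0 : R).
Proof.
move=> sB hx FK ThK drift ThF j.
suff h : forall i, (fun t => ((Th t)^T *m G)^T i 0) @ \oo --> 0.
  by have := h j; under eq_fun do rewrite mxE.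
apply: (rich_excitation_cvg0 hx) => h.
have ThFh c : (fun t => dotv (Th t) (F (t + c)%N%:Z)) @ \oo --> 0.
  have h1 : (fun t => dotv (Th (t + c)%N) (F (t + c)%N%:Z)) @ \oo --> 0.
    exact: (cvg0_subseq (s := fun t => (t + c)%N) (leq_addr _) ThF).
  have h2 : (fun t => dotv (Th (t + c)%N - Th t) (F (t + c)%N%:Z)) @ \oo --> 0.
    apply: (dotv_cvg0 (K := K)) => [i|t i]; last exact: FK.
    by under eq_fun do rewrite !mxE; exact: slow_drift.
  have := cvg0D h1 (cvg0Ml (-1) h2); apply: cvg_trans; apply: near_eq_cvg.
  by near=> t; rewrite dotvBl; ring.
have hfil : (fun t => \sum_i Th t i 0 * filtered i (t + h)%N) @ \oo --> 0.
  have : (fun t => \sum_(l < size B) B`_l * dotv (Th t) (F (t + (h + s - l))%N%:Z))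
            @ \oo --> 0.
    by apply: cvg0_sum => l; exact: cvg0Ml.
  apply: cvg_trans; apply: near_eq_cvg; near=> t.
  rewrite /filtered /qfilter.
  under [RHS]eq_bigr do rewrite mulr_sumr.
  rewrite exchange_big; apply: eq_bigr => l _ /=.
  have -> : (t + h + s)%N%:Z - l%:Z = (t + (h + s - l))%N%:Z.
    by have := ltn_ord l; clear - sB; lia.
  by rewrite dotv_sum mulr_sumr; apply: eq_bigr => i _; rewrite mulrCA.
have hres : (fun t => \sum_i Th t i 0 * residual i (t + h)%N) @ \oo --> 0.
  apply: cvg0_sum => i; under eq_fun do rewrite mulrC.
  apply: (cvg0M_bounded (K := K')) => [|t]; last exact: ThK.
  exact: (cvg0_subseq (s := fun t => (t + h)%N) (leq_addr _) (residual_cvg0 i)).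
have := cvg0D hfil (cvg0Ml (-1) hres); apply: cvg_trans; apply: near_eq_cvg.
by near=> t; rewrite dotv_filtered; ring.
Unshelve. all: by end_near. Qed.

End FilteredRegressor.

Theorem theorem2 (R : realType) (m1 m2 d p : nat)
    (A B F alpha : {poly R}) (gamma : R) (D yref y u : int -> R)
    (th : int -> 'cV[R]_(regdim m1 m2 d))
    (hd : (1 <= d)%N)
    (hA : A`_0 = 1) (sA : (size A <= m1.+1)%N)
    (hB : B`_0 != 0) (sB : (size B <= m2.+1)%N)
    (hFalpha : bezout_delay m1 d A F alpha)
    (hgamma : [/\ 0 < gamma, gamma < 2 & gamma != 1])
    (hplant : forall k : int, 0 <= k -> plant A B d D u y k)
    (hD : forall k : int, D k = 0)
    (hth0 : nu_part (th (- 1)) != 0)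
    (hcontroller : forall k : int, 0 <= k -> controller yref y u th k)
    (hestimator : forall k : int, 0 <= k -> estimator gamma y u th k)
    (hzeros : zeros_inside_unit_disk B)
    (hbounded : exists C : R, forall k : int, 0 <= k -> `|yref k| <= C)
    (hp : (1 <= p <= m1 + m2 + d)%N)
    (hrich : sufficiently_rich_constant (m1 + m2 + d) p yref) :
  [/\ (fun k : nat => y k%:Z - yref k%:Z) @ \oo --> (0 : R),
      exists2 Omega : {vspace 'cV[R]_(regdim m1 m2 d)}, \dim Omega = p &
        converges_to_set (fun k : nat => Phi m1 m2 d y u k%:Z)
                         [set v | v \in Omega]
    & converges_to_set
        (fun k : nat => th k%:Z - theta_star m1 m2 d alpha (F * B))
        (Omega_bar m1 m2 d y u)].
Proof.
have D0 : D = fun=> 0 by apply/funext.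
rewrite {}D0 in hplant; case: hgamma => g0 g2 g1.
set ths := theta_star _ _ _ _ _.
have hy := plant_regression hd sB hFalpha hplant.
have hc k : 0 <= k -> dotv (th k) (Phi m1 m2 d y u k) = yref (k + d%:Z).
  move=> k0; apply: controller_certainty_equivalence; last exact: hcontroller.
  by case: k k0 => // n _; exact: (nu_part_neq0 g1 hth0 hestimator).
have g02 : 0 < gamma < 2 by rewrite g0.
have [e0 [K hK] [K' hK'] drift] :=
  adaptive_loop_convergence hd sA hB hzeros g02 hplant hbounded hy hc hestimator.
have hwin i := filtered_regressor_window i hd sA sB hplant e0 hrich.
have [g hg] := choice hwin.
pose G : 'M[R]_(regdim m1 m2 d, p) := \matrix_(i, j) g i j 0.
have hG i : (fun t : nat =>
     qfilter B (fun k => Phi m1 m2 d y u k i 0) (t + (m1 + m2))%N%:Z -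
     dotv (row i G)^T (xi p yref t)) @ \oo --> 0.
  have -> : (row i G)^T = g i by apply/colP => j; rewrite !mxE.
  exact: hg.
have kerG v (vG : v^T *m G = 0) := kernel_regressor_cvg0 hG hB hzeros vG.
have ThF : (fun k : nat => dotv (th k%:Z - ths) (Phi m1 m2 d y u k%:Z)) @ \oo --> 0.
  have := cvg0Ml (-1) (cvg0_subseq (s := fun t => (t + d)%N) (leq_addr _) e0).
  apply: cvg_trans; apply: near_eq_cvg; near=> k.
  by rewrite /= PoszD hy // -hc // dotvBl; ring.
split=> //.
  by apply: (converges_to_image (G := G)) => //; rewrite leqnn regdimE //; case/andP: hp.
apply: (converges_to_kernel (C := G)) => [v vG|]; first exact: kerG.
apply: (orthogonal_slow_cvg0 hG _ _ hK hK') => //; last by case: hrich.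
lia.
Unshelve. all: by end_near. Qed.
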